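(* Let $\mu$ be a positive operator-valued measure on $\mathbb{T}$ satisfying the standing assumptions listed in the context, with normalized orthogonal polynomials $\varphi_k^R,\varphi_k^L$. For $n\ge0$ and $z,w\in\mathbb{C}$ define the right and left kernel polynomials $$K_n^R(w,z)=\sum_{k=0}^n\varphi_k^R(z)\varphi_k^R(w)^\dagger,\qquad K_n^L(w,z)=\sum_{k=0}^n\varphi_k^L(w)^\dagger\varphi_k^L(z).$$ Then: 1. $K_n^R(w,z)=[I\ \ zI\ \cdots\ z^nI]\,(T_{n+1}^R)^{-1}\begin{bmatrix}I\\ \bar wI\\ \vdots\\ \bar w^{n}I\end{bmatrix}.$ 2. $K_n^L(w,z)=[I\ \ \bar wI\ \cdots\ \bar w^{n}I]\,(T_{n+1}^L)^{-1}\begin{bmatrix}I\\ zI\\ \vdots\\ z^{n}I\end{bmatrix}.$ 3. (Christoffel–Darboux formulae) If $\bar wz\ne1$, then $$K_n^L(w,z)=\frac{\varphi_n^{R,*}(w)^\dagger\varphi_n^{R,*}(z)-\bar wz\,\varphi_n^L(w)^\dagger\varphi_n^L(z)}{1-\bar wz},$$ $$K_n^R(w,z)=\frac{\varphi_n^{L,*}(z)\varphi_n^{L,*}(w)^\dagger-\bar wz\,\varphi_n^R(z)\varphi_n^R(w)^\dagger}{1-\bar wz}.$$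
   Context: $\mathcal{H}$ is a separable complex Hilbert space, $\mathcal{L}(\mathcal{H})$ its bounded operators, $A^\dagger=A^*$ the adjoint, $\mathbb{T}$ the unit circle. An operator $A$ is positive definite if $\langle Ax,x\rangle>0$ for all $x\ne0$ and $A$ has a bounded inverse. A positive operator-valued measure is a map $\mu$ from the Borel sets of $\mathbb{T}$ to $\mathcal{L}(\mathcal{H})$ such that $\sigma\mapsto\langle\mu(\sigma)h,h\rangle$ is a positive Borel measure for every $h\in\mathcal{H}$. Its moments are $\mu_j=\int_{\mathbb{T}}e^{-ij\theta}\,d\mu(\theta)\in\mathcal{L}(\mathcal{H})$, $j\in\mathbb{Z}$, so $\mu_{-j}=\mu_j^*$. For $n\ge1$ the Toeplitz operator matrices on $\mathcal{H}^n$ are $T_n^R=[\mu_{j-k}]_{j,k=0}^{n-1}$ and $T_n^L=[\mu_{k-j}]_{j,k=0}^{n-1}$. Standing assumptions on $\mu$: $\mu$ is absolutely continuous, i.e. there is a weakly measurable $\mu':\mathbb{T}\to\mathcal{L}(\mathcal{H})$, $\mu'\ge0$ a.e., with $d\langle\mu(\theta)h,h\rangle=\langle\mu'(e^{i\theta})h,h\rangle\frac{d\theta}{2\pi}$ for all $h$; and $\mu$ is nontrivial, in the sense that $T_n^R$ and $T_n^L$ are positive definite (with bounded inverse) for all $n\ge1$. Put $\nu_n=(\mu_{-n},\dots,\mu_{-1})^{T}$ and $\xi_n=(\mu_n,\dots,\mu_1)^{T}$ (block columns, entries not adjointed), $\kappa_n^R=\mu_0-\nu_n^*(T_n^R)^{-1}\nu_n$,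 $\kappa_n^L=\mu_0-\xi_n^*(T_n^L)^{-1}\xi_n$, $\kappa_0^R=\kappa_0^L=\mu_0$; these are positive definite, and $\kappa_n^{-R/2},\kappa_n^{-L/2}$ denote the inverses of their positive definite square roots. The monic orthogonal polynomials are $\Phi_0^R=\Phi_0^L=I$ and, for $n\ge1$, $$\Phi_n^R(z)=z^nI-[I\ \ zI\ \cdots\ z^{n-1}I](T_n^R)^{-1}\nu_n,\qquad \Phi_n^L(z)=z^nI-\xi_n^*(T_n^L)^{-1}\begin{pmatrix}I\\ zI\\ \vdots\\ z^{n-1}I\end{pmatrix}.$$ The normalized ones are $\varphi_n^R=\Phi_n^R\kappa_n^{-R/2}$ and $\varphi_n^L=\kappa_n^{-L/2}\Phi_n^L$. For an operator polynomial $P_n$ of degree $n$, the reversed polynomial is $P_n^*(z)=z^nP_n(1/\bar z)^\dagger$; $\varphi_n^{R,*},\varphi_n^{L,*}$ are the reversed polynomials of $\varphi_n^R,\varphi_n^L$. *)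

(* Defs.v *)
From HB Require Import structures.
From mathcomp Require Import all_boot all_order all_algebra.
From mathcomp Require Import sesquilinear.
From mathcomp.real_closed Require Import complex.
From mathcomp Require Import all_classical all_reals all_analysis.

Set Implicit Arguments.
Unset Strict Implicit.
Unset Printing Implicit Defensive.

Import Order.TTheory GRing.Theory Num.Theory.
Import numFieldNormedType.Exports.

Local Open Scope classical_set_scope.
Local Open Scope ring_scope.
Local Open Scope complex_scope.

HB.mixin Record isHilbert (R : realType) H of CompleteNormedModule R[i] H := {
  hdot : {dot H for (Num.conj : R[i] -> R[i])} ;
  hdot_norm : forall x, hdot x x = `|x| ^+ 2 }.

#[short(type="hilbertType")]
HB.structure Definition Hilbert (R : realType) :=
  {H of isHilbert R H & CompleteNormedModule R[i] H}.

Notation "''[' x , y ]" := (hdot x y) (format "''[' x ,  y ]") : ring_scope.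

Definition separable_space (T : topologicalType) :=
  exists D : set T, countable D /\ dense D.

Section BoundedOperators.
Context {R : realType} {H : hilbertType R}.

Definition bounded_operator : {pred H -> H} :=
  mem [set f | linear f /\ exists M, forall x, `|f x| <= M * `|x|].

Record bop := Bop { bop_fun :> H -> H ; _ : bop_fun \in bounded_operator }.

HB.instance Definition _ := [isSub for bop_fun].
HB.instance Definition _ := [Choice of bop by <:].

Lemma bounded_operatorP (f : H -> H) : f \in bounded_operator <->
  linear f /\ exists M, forall x, `|f x| <= M * `|x|.
Proof. by split=> [/set_mem|/mem_set]. Qed.

Lemma bounded_operator_submod : submod_closed bounded_operator.
Proof.
split.
  apply/bounded_operatorP; split; first by move=> a x y; rewrite /= scaler0 addr0.
  by exists 0 => x; rewrite normr0 mul0r.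
move=> a f g /bounded_operatorP[lf [M fM]] /bounded_operatorP[lg [N gN]].
apply/bounded_operatorP; split.
  move=> b x y; rewrite !fctE lf lg !scalerDr !scalerA (mulrC a b).
  by rewrite -!addrA; congr (_ + _); rewrite addrCA.
exists (`|a| * M + N) => x; rewrite !fctE mulrDl (le_trans (ler_normD _ _))//.
by rewrite lerD// normrZ -mulrA ler_wpM2l.
Qed.

HB.instance Definition _ :=
  GRing.isSubmodClosed.Build R[i] (H -> H) bounded_operator
    bounded_operator_submod.
HB.instance Definition _ := [SubChoice_isSubLmodule of bop by <:].

Lemma bop_linear (A : bop) : linear A.
Proof. by have /bounded_operatorP[] := valP A. Qed.

Lemma bop_bounded (A : bop) : exists M, forall x, `|A x| <= M * `|x|.
Proof. by have /bounded_operatorP[] := valP A. Qed.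

Lemma bopP (A B : bop) : (forall x, A x = B x) -> A = B.
Proof. by move=> AB; apply/val_inj/funext. Qed.

HB.instance Definition _ (A : bop) := GRing.isLinear.Build _ _ _ _ _ (bop_linear A).

Lemma bop1_subproof : (id : H -> H) \in bounded_operator.
Proof. by apply/bounded_operatorP; split=> //; exists 1 => x; rewrite mul1r. Qed.

Lemma bopM_subproof (A B : bop) : (A \o B : H -> H) \in bounded_operator.
Proof.
apply/bounded_operatorP; split; first exact: linearP.
have [M AM] := bop_bounded A; have [N BN] := bop_bounded B.
exists (`|M| * N) => x /=.
have /le_trans -> // : `|A (B x)| <= `|M| * `|B x|.
  rewrite -[in leRHS](normr_id (B x)) -normrM ger0_norm ?AM//.
  exact: le_trans (AM (B x)).
by rewrite -mulrA ler_wpM2l.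
Qed.

Let bop1 := Bop bop1_subproof.
Let bopM (A B : bop) := Bop (bopM_subproof A B).

Lemma bopA_subproof : associative bopM. Proof. by move=> A B C; exact/bopP. Qed.
Lemma bop1l_subproof : left_id bop1 bopM. Proof. by move=> A; exact/bopP. Qed.
Lemma bop1r_subproof : right_id bop1 bopM. Proof. by move=> A; exact/bopP. Qed.
Lemma bopDl_subproof : left_distributive bopM +%R.
Proof. by move=> A B C; exact/bopP. Qed.
Lemma bopDr_subproof : right_distributive bopM +%R.
Proof. by move=> A B C; apply/bopP => x; exact: linearD. Qed.

(* Only a pzRingType, since H may be the zero space. *)
HB.instance Definition _ := GRing.Zmodule_isPzRing.Build bop
  bopA_subproof bop1l_subproof bop1r_subproof bopDl_subproof bopDr_subproof.

Lemma bopME (A B : bop) x : (A * B) x = A (B x). Proof. by []. Qed.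
Lemma bop1E x : (1 : bop) x = x. Proof. by []. Qed.
Lemma bopDE (A B : bop) x : (A + B) x = A x + B x. Proof. by []. Qed.
Lemma bopZE (a : R[i]) (A : bop) x : (a *: A) x = a *: A x. Proof. by []. Qed.

Lemma bop_scalerAl (a : R[i]) (A B : bop) : a *: (A * B) = (a *: A) * B.
Proof. exact: bopP. Qed.

Lemma bop_scalerAr (a : R[i]) (A B : bop) : a *: (A * B) = A * (a *: B).
Proof. by apply: bopP => x; rewrite bopME /= linearZ. Qed.

End BoundedOperators.

Arguments bop {R} H.

Section Inverse.
Context {S : pzRingType}.

Definition two_sided_inverse (x y : S) := x * y = 1 /\ y * x = 1.

Definition rinv (x : S) : S := xget 0 [set y | two_sided_inverse x y].

End Inverse.

Section Operators.
Context {R : realType} {H : hilbertType R}.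
Implicit Types A B : bop H.

(* A bounded operator has exactly one adjoint; likewise the inverse rinv and the
   positive definite square root op_sqrt are unique, so that xget selects the
   intended element whenever there is one. *)
Definition adj A : bop H := xget 0 [set B : bop H | forall x y, '[A x, y] = '[x, B y]].

Definition adjmx m n (A : 'M[bop H]_(m, n)) : 'M[bop H]_(n, m) :=
  map_mx adj A^T.

(* An n x n matrix over L(H) acting on H^n; every bounded operator on H^n arises
   from a unique such matrix, so that a bounded inverse on H^n is the same thing
   as an inverse in the ring of matrices over L(H). *)
Definition mxact m n (A : 'M[bop H]_(m, n)) (x : 'cV[H]_n) : 'cV[H]_m :=
  \col_i \sum_j A i j (x j 0).

Definition hdotv n (x y : 'cV[H]_n) : R[i] := \sum_i '[x i 0, y i 0].

Definition posdef A := (forall x, x != 0 -> 0 < '[A x, x]) /\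
  exists B, two_sided_inverse A B.

Definition posdefmx n (A : 'M[bop H]_n) :=
  (forall x, x != 0 -> 0 < hdotv (mxact A x) x) /\
  exists B : 'M[bop H]_n, two_sided_inverse A B.

Definition op_sqrt A : bop H := xget 0 [set B : bop H | posdef B /\ B * B = A].

(* An operator polynomial of degree (at most) n, given by its coefficients. *)
Definition oppoly n := {ffun 'I_n.+1 -> bop H}.

Definition peval n (P : oppoly n) (z : R[i]) : bop H :=
  \sum_(k < n.+1) z ^+ k *: P k.

(* The formula z^n P(1/conj z)^* makes sense for z != 0 only; the value at 0 is
   the constant coefficient of the polynomial it defines, i.e., the adjoint of
   the coefficient of z^n in P. *)
Definition reversed n (P : oppoly n) (z : R[i]) : bop H :=
  if z == 0 then adj (P ord_max) else z ^+ n *: adj (peval P ((z^*)%R)^-1).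

Definition zrow n (z : R[i]) : 'rV[bop H]_n := \row_j (z ^+ j *: (1 : bop H)).
Definition zcol n (z : R[i]) : 'cV[bop H]_n := \col_j (z ^+ j *: (1 : bop H)).

End Operators.

Section Circle.
Variable R : realType.

Definition unit_circle : set R[i]^o := [set z | `|z| = 1].
Definition circle := set_type unit_circle.

HB.instance Definition _ := Topological.on circle.

Lemma expi_subproof (t : R) : (cos t +i* sin t)%C \in unit_circle.
Proof. by rewrite inE /unit_circle /= normc_def /= cos2Dsin2 sqrtr1. Qed.

Definition expi (t : R) : circle :=
  exist (fun z => z \in unit_circle) _ (expi_subproof t).

HB.instance Definition _ := isPointed.Build circle (expi 0).

HB.instance Definition _ := Measurable.copy circle
  (g_sigma_algebraType (@open circle)).

Definition cintegral (m : {measure set circle -> \bar R}) (f : circle -> R[i]) :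
    R[i] :=
  ((\int[m]_z complex.Re (f z)) +i* (\int[m]_z complex.Im (f z)))%C.

End Circle.

Section POVM.
Context {R : realType} (H : hilbertType R).

Record povm := Povm {
  povm_op :> set (circle R) -> bop H ;
  povm_form : H -> {measure set (circle R) -> \bar R} ;
  povm_formE : forall h A, measurable A ->
    exists2 r : R, '[povm_op A h, h] = r%:C%C & povm_form h A = r%:E }.

Variable mu : povm.

(* The weak integral of z^(-j) = e^(-ij theta); an operator on a complex Hilbert
   space is determined by its quadratic form. *)
Definition moment (j : int) : bop H :=
  xget 0 [set A : bop H | forall h,
    '[A h, h] = cintegral (povm_form mu h) (fun z => (val z : R[i]) ^ (- j))].

Definition weakly_measurable (f : circle R -> bop H) := forall h k,
  measurable_fun setT (fun z => complex.Re '[f z h, k]) /\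
  measurable_fun setT (fun z => complex.Im '[f z h, k]).

Definition povm_abs_continuous := exists mu' : circle R -> bop H,
  [/\ weakly_measurable mu',
      {ae lebesgue_measure, forall t : R, forall h, 0 <= '[mu' (expi t) h, h]} &
      forall h A, measurable A -> povm_form mu h A =
        (\int[lebesgue_measure]_(t in `[0%R, (2 * pi)%R[ `&` expi (R:=R) @^-1` A)
          (complex.Re '[mu' (expi t) h, h] / (2 * pi))%R%:E)%E ].

Definition TR n : 'M[bop H]_n := \matrix_(j, k) moment (j%:Z - k%:Z).
Definition TL n : 'M[bop H]_n := \matrix_(j, k) moment (k%:Z - j%:Z).

Definition povm_nontrivial :=
  forall n, (0 < n)%N -> posdefmx (TR n) /\ posdefmx (TL n).

Definition nu n : 'cV[bop H]_n := \col_i moment (i%:Z - n%:Z).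
Definition xi n : 'cV[bop H]_n := \col_i moment (n%:Z - i%:Z).

(* For n = 0 the block matrices below are empty: kappaR 0 = kappaL 0 = moment 0
   and PhiR 0 = PhiL 0 = 1. *)
Definition kappaR n : bop H :=
  moment 0 - (adjmx (nu n) *m rinv (TR n) *m nu n) 0 0.
Definition kappaL n : bop H :=
  moment 0 - (adjmx (xi n) *m rinv (TL n) *m xi n) 0 0.

(* The coefficient of z^n is 1; those of z^0, ..., z^(n-1) are read off the
   block column - T^-1 nu, respectively the block row - xi^* T^-1. *)
Definition PhiR n : oppoly n := [ffun k =>
  if unlift ord_max k is Some j then - (rinv (TR n) *m nu n) j 0 else 1].
Definition PhiL n : oppoly n := [ffun k =>
  if unlift ord_max k is Some j then - (adjmx (xi n) *m rinv (TL n)) 0 j else 1].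

Lemma PhiRE n z : peval (PhiR n) z =
  z ^+ n *: (1 : bop H) - (zrow n z *m rinv (TR n) *m nu n) 0 0.
Proof.
rewrite /peval big_ord_recr /= [in X in _ + X]ffunE unlift_none addrC.
congr (_ + _).
rewrite -mulmxA mxE -sumrN; apply: eq_bigr => i _.
have -> : widen_ord (leqnSn n) i = lift ord_max i.
  by apply: val_inj; rewrite /= /bump leqNgt ltn_ord.
by rewrite ffunE liftK [zrow _ _ _ _]mxE -bop_scalerAl mul1r scalerN.
Qed.

Lemma PhiLE n z : peval (PhiL n) z =
  z ^+ n *: (1 : bop H) - (adjmx (xi n) *m rinv (TL n) *m zcol n z) 0 0.
Proof.
rewrite /peval big_ord_recr /= [in X in _ + X]ffunE unlift_none addrC.
congr (_ + _).
rewrite mxE -sumrN; apply: eq_bigr => i _.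
have -> : widen_ord (leqnSn n) i = lift ord_max i.
  by apply: val_inj; rewrite /= /bump leqNgt ltn_ord.
by rewrite ffunE liftK [zcol _ _ _ _]mxE -bop_scalerAr mulr1 scalerN.
Qed.

Definition phiR n : oppoly n :=
  [ffun k => PhiR n k * rinv (op_sqrt (kappaR n))].
Definition phiL n : oppoly n :=
  [ffun k => rinv (op_sqrt (kappaL n)) * PhiL n k].

Definition KR n (w z : R[i]) : bop H :=
  \sum_(k < n.+1) peval (phiR k) z * adj (peval (phiR k) w).
Definition KL n (w z : R[i]) : bop H :=
  \sum_(k < n.+1) adj (peval (phiL k) w) * peval (phiL k) z.

End POVM.

(* Main.v *)
Require Import Defs.
From mathcomp Require Import all_boot all_order all_algebra.
From mathcomp.real_closed Require Import complex.
From mathcomp Require Import all_classical all_reals all_analysis.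
From mathcomp Require Import ring lra zify.
Import Order.TTheory GRing.Theory Num.Theory.
Import numFieldNormedType.Exports.

Local Open Scope ring_scope.
Local Open Scope complex_scope.

Set Implicit Arguments.
Unset Strict Implicit.
Unset Printing Implicit Defensive.

(** The kernel polynomials are quadratic forms in the inverse Toeplitz matrices,
    and both the orthogonal polynomials and the Christoffel-Darboux formulae
    come from bordering these matrices by one row and one column.

    Splitting the last index off T_(n+1) gives T_n bordered by a column b, the
    row b^* and a corner entry; with kappa the Schur complement of T_n,
<<
        T_(n+1)^-1 = diag(T_n^-1, 0) + p kappa^-1 p^*,     p = (- T_n^-1 b, 1).
>>
    For T^R the column p lists the coefficients of Phi_n^R, for T^L the row p^*
    lists those of Phi_n^L. Hence the form of T_(n+1)^-1 evaluated at powers of z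
    and conj w exceeds that of T_n^-1 by exactly the n-th summand of the kernel
    polynomial ([bform_TR_powers], [bform_TL_powers]), and parts 1 and 2 follow
    by induction from the empty matrix ([KRE], [KLE]).

    Reversing the order of the indices exchanges T^R and T^L. Performing the last
    splitting on the reversed matrix therefore amounts to splitting the first
    index off T_(n+1): the lower right block contributes the form of T_n^-1
    multiplied by (conj w) z, because all powers are shifted by one, and the
    rank-one term consists of reversed polynomials of the opposite side
    ([bform_TL_reversed], [bform_TR_reversed]). With c = (conj w) z, comparing
    K_n = c K_(n-1) + X with K_n = K_(n-1) + Y gives (1 - c) K_n = X - c Y, which
    is part 3.

    Positivity of the Toeplitz matrices makes them hermitian, by polarization:
    the moments mu_j and mu_(-j) are adjoint to each other, and the adjoints of
    all other operators are computed from these ([posdefmx_selfadj],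
    [schur_col_adj]). The normalized polynomials involve
    kappa^(1/2); the existence of a positive definite square root
    ([posdef_sqrt]) is proved with an iteration that contracts geometrically,
    because a positive definite operator with a bounded inverse is bounded
    below. *)

(** * The inner product *)

Section InnerProduct.
Context {R : realType} {H : hilbertType R}.
Implicit Types (x y z : H) (a : R[i]).

Lemma hdotDl x y z : '[x + y, z] = '[x, z] + '[y, z].
Proof. exact: linearDl. Qed.

Lemma hdotZl a x y : '[a *: x, y] = a * '[x, y].
Proof. exact: linearZl_LR. Qed.

Lemma hdotC x y : '[x, y] = (('[y, x])^*)%R.
Proof. by rewrite [LHS]hermC expr0 mul1r. Qed.

Lemma hdotDr x y z : '[x, y + z] = '[x, y] + '[x, z].
Proof. exact: linearDr. Qed.

Lemma hdotZr a x y : '[x, a *: y] = (a^*)%R * '[x, y].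
Proof. by rewrite hdotC hdotZl rmorphM /= -hdotC. Qed.

Lemma hdotNl x y : '[- x, y] = - '[x, y].
Proof. exact: linearNl. Qed.

Lemma hdotNr x y : '[x, - y] = - '[x, y].
Proof. exact: linearNr. Qed.

Lemma hdotBl x y z : '[x - y, z] = '[x, z] - '[y, z].
Proof. by rewrite hdotDl hdotNl. Qed.

Lemma hdotBr x y z : '[x, y - z] = '[x, y] - '[x, z].
Proof. by rewrite hdotDr hdotNr. Qed.

Lemma hdot0l x : '[0, x] = 0.
Proof. exact: linear0l. Qed.

Lemma hdot0r x : '[x, 0] = 0.
Proof. exact: linear0r. Qed.

Lemma hdot_suml n (F : 'I_n -> H) y : '[\sum_i F i, y] = \sum_i '[F i, y].
Proof.
by elim/big_ind2: _ => [|a u b v <- <-|//]; rewrite ?hdot0l ?hdotDl.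
Qed.

Lemma hdot_sumr n (F : 'I_n -> H) y : '[y, \sum_i F i] = \sum_i '[y, F i].
Proof.
by elim/big_ind2: _ => [|a u b v <- <-|//]; rewrite ?hdot0r ?hdotDr.
Qed.

Lemma hdot_eq0 x : (forall y, '[x, y] = 0) -> x = 0.
Proof.
move=> /(_ x)/eqP; rewrite hdot_norm sqrf_eq0 normr_eq0; exact: eqP.
Qed.

Lemma hdot_inj x y : (forall z, '[x, z] = '[y, z]) -> x = y.
Proof.
move=> xy; apply/eqP; rewrite -subr_eq0; apply/eqP/hdot_eq0 => z.
by rewrite hdotBl xy subrr.
Qed.

Lemma hdotP x y : (forall z, '[z, x] = '[z, y]) -> x = y.
Proof. by move=> xy; apply: hdot_inj => z; rewrite hdotC xy -hdotC. Qed.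

(** The square of the norm of x minus its projection onto the line of y is
    nonnegative. *)
Lemma cauchy_schwarz x y : `|'[x, y]| <= `|x| * `|y|.
Proof.
have [->|y0] := eqVneq y 0; first by rewrite hdot0r !normr0 mulr0.
have ny0 : `|y| != 0 by rewrite normr_eq0.
rewrite -ler_sqr ?nnegrE ?mulr_ge0// exprMn.
set c := '[x, y]; set t := c / `|y| ^+ 2.
have : 0 <= '[x - t *: y, x - t *: y] by rewrite hdot_norm exprn_ge0.
have tE : t * `|y| ^+ 2 = c by rewrite divfK// expf_neq0.
have ctE : t * (c^*)%R = `|c| ^+ 2 / `|y| ^+ 2 by rewrite normCK mulrAC.
rewrite !(hdotBl, hdotBr, hdotZl, hdotZr) !hdot_norm (hdotC y x) -/c.
have -> : t * ((t^*)%R * `|y| ^+ 2) = (t^*)%R * c by rewrite mulrCA tE.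
rewrite ctE opprB addrA addrNK subr_ge0.
by rewrite ler_pdivrMr// exprn_gt0// normr_gt0.
Qed.

End InnerProduct.

(** * Sequences with a geometric error bound *)

Section Limits.
Context {R : realType}.

(** Limit arguments over the partially ordered field R[i] are reduced to this
    estimate. The case n = 0 shows that a and b have the same imaginary part, so
    that only their real parts remain to be compared. *)
Lemma le_of_geometric_error (a b C q : R[i]) :
  0 <= C -> 0 <= q -> q < 1 -> (forall n, a <= b + C * q ^+ n) -> a <= b.
Proof.
case: a b C q => [ar ai] [br bi] [cr ci] [qr qi].
rewrite !lecE /= ltcE /= => /andP[/eqP ci0 c0] /andP[/eqP qi0 q0] /andP[_ q1].
rewrite ci0 qi0 => ab.
have {}ab n : (bi == ai) && (ar <= br + cr * qr ^+ n).
  have := ab n; rewrite -[qr +i* 0]/(qr%:C) -(rmorphXn (real_complex R)).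
  by rewrite lecE /= !(mul0r,mulr0,addr0,subr0).
have /andP[-> _] := ab 0%N; rewrite leNgt; apply/negP => lt_ba.
have q1' : `|qr| < 1 by rewrite ger0_norm.
have := cvg_geometric cr q1'.
move/cvgrPdist_lt => /(_ (ar - br)).
rewrite subr_gt0 => /(_ lt_ba)[n _ /(_ n (leqnn n))].
rewrite sub0r normrN ger0_norm ?mulr_ge0 ?exprn_ge0// ltNge lerBlDl.
by have /andP[_ ->] := ab n.
Qed.

Lemma eq0_of_geometric_error (V : normedZmodType R[i]) (x : V) (C q : R[i]) :
  0 <= C -> 0 <= q -> q < 1 -> (forall n, `|x| <= C * q ^+ n) -> x = 0.
Proof.
move=> C0 q0 q1 xC; apply/eqP; rewrite -normr_le0.
by apply: (le_of_geometric_error C0 q0 q1) => n; rewrite add0r.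
Qed.

(** The limit inherits the error bounds of the sequence, in a form that
    [le_of_geometric_error] turns into closed conditions on the limit. *)
Lemma geometric_cauchy_limit (V : completeNormedModType R[i]) (u : nat -> V)
    (C q : R[i]) : 0 <= C -> 0 <= q -> q < 1 ->
  (forall n k, `|u (n + k)%N - u n| <= C * q ^+ n) ->
  exists l, forall n, `|l - u n| <= C * q ^+ n.
Proof.
move=> C0 q0 q1 uC.
have small e : 0 < e -> exists n, C * q ^+ n < e.
  move=> e0; apply: contrapT => /forallNP ne.
  suff : e <= 0 by move=> /(lt_le_trans e0); rewrite ltxx.
  apply: (le_of_geometric_error C0 q0 q1) => n; rewrite add0r.
  rewrite real_leNgt; first exact/negP/ne.
    exact: gtr0_real.
  by rewrite ger0_real// mulr_ge0// exprn_ge0.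
have : cauchy (u @ \oo)%classic.
  apply: cauchy_exP => e /small[n une]; exists (u n).
  exists n => // k /= nk; rewrite -ball_normE /= distrC.
  by rewrite -(subnKC nk); apply: le_lt_trans (uC n _) une.
move=> /cauchy_cvg/cvg_ex[l ul]; exists l => n.
rewrite real_leNgt ?normr_real//; last first.
  by rewrite ger0_real// mulr_ge0// exprn_ge0.
apply/negP; rewrite -subr_gt0 => e0.
move/cvgrPdist_lt: ul => /(_ _ e0)[N _ /(_ (n + N)%N (leq_addl _ _)) uN].
have := le_lt_trans (ler_distD (u (n + N)%N) l (u n)) (ltr_leD uN (uC n N)).
by rewrite subrK ltxx.
Qed.

End Limits.

(** * Adjoints and inverses *)

Section Adjoints.
Context {R : realType} {H : hilbertType R}.
Implicit Types (A B : bop H) (x y : H).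

(** Adjunction as a relation: being symmetric and compatible with the algebraic
    operations, it yields the values of [adj] on every operator built from
    operators with a known adjoint. *)
Definition is_adj A B := forall x y, '[A x, y] = '[x, B y].

Lemma is_adjE A B : is_adj A B -> adj A = B.
Proof.
move=> AB; have /= : is_adj A (adj A) by apply: xgetI AB.
by move=> AadjA; apply: bopP => y; apply: hdotP => x; rewrite -AB AadjA.
Qed.

Lemma is_adj_sym A B : is_adj A B -> is_adj B A.
Proof. by move=> AB x y; rewrite hdotC -AB -hdotC. Qed.

Lemma is_adj1 : is_adj 1 1. Proof. by []. Qed.

Lemma is_adj0 : is_adj 0 0.
Proof. by move=> x y; rewrite hdot0l hdot0r. Qed.

Lemma is_adjD A A' B B' :
  is_adj A A' -> is_adj B B' -> is_adj (A + B) (A' + B').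
Proof. by move=> hA hB x y; rewrite !bopDE hdotDl hdotDr hA hB. Qed.

Lemma is_adjZ a A A' : is_adj A A' -> is_adj (a *: A) ((a^*)%R *: A').
Proof. by move=> hA x y; rewrite !bopZE hdotZl hdotZr conjCK hA. Qed.

Lemma is_adjN A A' : is_adj A A' -> is_adj (- A) (- A').
Proof.
by move=> hA; have := is_adjZ (-1) hA; rewrite rmorphN rmorph1 !scaleN1r.
Qed.

Lemma is_adjM A A' B B' :
  is_adj A A' -> is_adj B B' -> is_adj (A * B) (B' * A').
Proof. by move=> hA hB x y; rewrite !bopME hA hB. Qed.

Lemma is_adj_sum n (F F' : 'I_n -> bop H) :
  (forall i, is_adj (F i) (F' i)) -> is_adj (\sum_i F i) (\sum_i F' i).
Proof.
move=> FF'.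
by apply: (big_ind2 is_adj is_adj0 (fun _ _ _ _ => @is_adjD _ _ _ _)).
Qed.

Lemma is_adj_inv A A' B B' : is_adj A A' ->
  two_sided_inverse A B -> two_sided_inverse A' B' -> is_adj B B'.
Proof.
move=> AA' [AB _] [AB' _] x y.
by rewrite -[y in LHS](bop1E y) -AB' bopME -AA' -bopME AB.
Qed.

Lemma bop_sumE n (F : 'I_n -> bop H) x : (\sum_i F i) x = \sum_i F i x.
Proof. by elim/big_ind2: _ => [//|a u b v <- <-|]. Qed.

Lemma bopBE A B x : (A - B) x = A x - B x. Proof. by []. Qed.

Lemma bopDr A x y : A (x + y) = A x + A y. Proof. exact: linearD. Qed.

Lemma bopBr A x y : A (x - y) = A x - A y. Proof. exact: linearB. Qed.

Lemma bopZr A a x : A (a *: x) = a *: A x. Proof. exact: linearZ. Qed.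

Lemma bop_bound A : exists2 M, 0 < M & forall x, `|A x| <= M * `|x|.
Proof.
have [M AM] := bop_bounded A; exists (`|M| + 1); first by rewrite ltr_wpDl.
move=> x; have M0 : 0 <= M * `|x| := le_trans (normr_ge0 _) (AM x).
rewrite mulrDl mul1r (le_trans (AM x))// -(ger0_norm M0) normrM normr_id.
by rewrite lerDl.
Qed.

End Adjoints.

Section Inverses.
Context {S : pzRingType}.
Implicit Types x y : S.

Lemma rinvE x y : two_sided_inverse x y -> rinv x = y.
Proof.
move=> xy; have [_ yx] := xy; have [x_rinv _] : two_sided_inverse x (rinv x).
  exact: xgetI xy.
by rewrite -[LHS]mul1r -yx -mulrA x_rinv mulr1.
Qed.

Lemma rinvP x y : two_sided_inverse x y -> two_sided_inverse x (rinv x).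
Proof. by move=> xy; rewrite (rinvE xy). Qed.

(** A square root s of x commutes with the inverse y of x. *)
Lemma two_sided_inverse_sqrt s x y : s * s = x -> two_sided_inverse x y ->
  two_sided_inverse s (s * y).
Proof.
move=> ss [xy yx]; split; first by rewrite mulrA ss.
have -> : s * y = y * s; last by rewrite -mulrA ss.
by rewrite -[RHS]mulr1 -xy -ss !mulrA -(mulrA y s s) ss yx mul1r.
Qed.

End Inverses.

(** Polarization: with f real on the diagonal, its values at x + y and x + i y
    show that f x y + f y x is real and that f x y - f y x is imaginary. *)
Lemma hermitian_of_real_diagonal (R : realType) (V : lmodType R[i])
    (f : V -> V -> R[i]) :
  (forall x y z, f (x + y) z = f x z + f y z) ->
  (forall x y z, f x (y + z) = f x y + f x z) ->
  (forall a x y, f (a *: x) y = a * f x y) ->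
  (forall a x y, f x (a *: y) = (a^*)%R * f x y) ->
  (forall x, f x x \is Num.real) -> forall x y, f x y = ((f y x)^*)%R.
Proof.
move=> Dl Dr Zl Zr fr x y.
have := fr (x + 'i *: y); have := fr (x + y).
rewrite !(Dl, Dr, Zl, Zr).
have := fr x; have := fr y; move: (f x x) (f y y) (f x y) (f y x).
move=> [xr xi] [yr yi] [pr pi] [qr qi].
rewrite !complex_real /=.
move=> /eqP yi0 /eqP xi0 /eqP h1 /eqP h2.
have -> : (qr +i* qi)^*%R = (qr +i* - qi) by [].
by congr (_ +i* _); lra.
Qed.

(** * Square roots of positive definite operators *)

Section SquareRoot.
Context {R : realType} {H : hilbertType R}.
Implicit Types (A B K : bop H) (x y : H).

Lemma selfadj_real A : is_adj A A -> forall x, '[A x, x] \is Num.real.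
Proof. by move=> AA x; apply/CrealP; rewrite -hdotC AA. Qed.

Lemma selfadj_of_real A : (forall x, '[A x, x] \is Num.real) -> is_adj A A.
Proof.
move=> rA x y; rewrite [RHS]hdotC.
apply: (hermitian_of_real_diagonal (f := fun x y => '[A x, y])) => //.
- by move=> a b c; rewrite bopDr hdotDl.
- by move=> a b c; rewrite hdotDr.
- by move=> a b c; rewrite bopZr hdotZl.
- by move=> a b c; rewrite hdotZr.
Qed.

Lemma posdef_ge0 A x : posdef A -> 0 <= '[A x, x].
Proof.
case=> Ap _; have [->|x0] := eqVneq x 0; last exact/ltW/Ap.
by rewrite hdot0r.
Qed.

Lemma posdef_selfadj A : posdef A -> is_adj A A.
Proof.
by move=> pA; apply: selfadj_of_real => x; exact/ger0_real/posdef_ge0.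
Qed.

(** With B the inverse of K and N a bound for B, expand the inequality
    0 <= <K v, v> at v = x - N^-1 B x. *)
Lemma posdef_lower_bound K : posdef K ->
  exists2 d : R[i], 0 < d & forall x, d * `|x| ^+ 2 <= '[K x, x].
Proof.
move=> pK; have adjK := posdef_selfadj pK; have [_ [B [KB BK]]] := pK.
have [N N0 BN] := bop_bound B; exists N^-1; first by rewrite invr_gt0.
have conjN : ((N^-1)^*)%R = N^-1 by apply/CrealP; rewrite realV gtr0_real.
move=> x; have := posdef_ge0 (x - N^-1 *: B x) pK.
rewrite bopBr bopZr -[K (B x)]bopME KB bop1E.
rewrite !(hdotBl, hdotBr, hdotZl, hdotZr) conjN (adjK x (B x)).
rewrite -(bopME K B) KB bop1E hdot_norm.
have xBx : '[x, B x] <= N * `|x| ^+ 2.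
  have := posdef_ge0 (B x) pK; rewrite -bopME KB bop1E => /ger0_norm <-.
  rewrite (le_trans (cauchy_schwarz _ _))// mulrC expr2 mulrA.
  by rewrite ler_wpM2r.
move=> h; rewrite -subr_ge0; apply: le_trans h _; rewrite gerBl subr_ge0.
by rewrite ler_pM2l ?invr_gt0// mulrC ler_pdivrMr// mulrC.
Qed.

(** Polarize between x and y = q^-1 A x: the difference of the quadratic form
    at x + y and x - y is 4 q^-1 |A x|^2, and the parallelogram identity bounds it
    by 2 q (|x|^2 + |y|^2). *)
Lemma numerical_radius_bound A (q : R[i]) : is_adj A A -> 0 < q ->
  (forall x, `|'[A x, x]| <= q * `|x| ^+ 2) -> forall x, `|A x| <= q * `|x|.
Proof.
move=> adjA q0 Aq x; set y := q^-1 *: A x.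
have q1 : ((q^-1)^*)%R = q^-1 by apply/CrealP; rewrite realV gtr0_real.
have par : `|x + y| ^+ 2 + `|x - y| ^+ 2 = 2 * (`|x| ^+ 2 + `|y| ^+ 2).
  by rewrite -!hdot_norm !(hdotBl, hdotBr, hdotDl, hdotDr); ring.
have polar :
    '[A (x + y), x + y] - '[A (x - y), x - y] = 4 * (q^-1 * `|A x| ^+ 2).
  have e1 : '[A x, y] = q^-1 * `|A x| ^+ 2 by rewrite hdotZr q1 hdot_norm.
  have e2 : '[A y, x] = q^-1 * `|A x| ^+ 2.
    by rewrite adjA hdotZl hdot_norm.
  by rewrite bopBr bopDr !(hdotBl, hdotBr, hdotDl, hdotDr) e1 e2; ring.
have yE : q * `|y| ^+ 2 = q^-1 * `|A x| ^+ 2.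
  rewrite normrZ gtr0_norm ?invr_gt0// exprMn.
  by rewrite expr2 !mulrA mulfV ?gt_eqF// mul1r.
have : 4 * (q^-1 * `|A x| ^+ 2) <= q * (2 * (`|x| ^+ 2 + `|y| ^+ 2)).
  rewrite -polar -par mulrDr; apply: le_trans (lerD (Aq _) (Aq _)).
  apply: le_trans (ler_normB _ _); apply: real_ler_norm.
  by rewrite realB// selfadj_real.
rewrite [leRHS]mulrCA (mulrDr q) yE.
have -> : 4 * (q^-1 * `|A x| ^+ 2) =
    2 * (q^-1 * `|A x| ^+ 2 + q^-1 * `|A x| ^+ 2) by ring.
rewrite ler_pM2l// lerD2r mulrC ler_pdivrMr// => Axq.
rewrite -ler_sqr ?nnegrE ?mulr_ge0//; last exact: ltW.
by rewrite exprMn (expr2 q) -mulrA [leRHS]mulrC.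
Qed.

(** A solution of L = (A + L^2) / 2 makes 1 - L a square root of 1 - A. When
    |A| <= q < 1, iterating the right-hand side from 0 stays in the ball of
    radius q, on which L |-> L^2 / 2 is q-Lipschitz; the iterates then converge
    at geometric speed at each vector. *)
Section Iteration.
Variables (A : bop H) (q : R[i]).
Hypotheses (adjA : is_adj A A) (q0 : 0 <= q) (q1 : q < 1).
Hypothesis Aq : forall x, `|A x| <= q * `|x|.

Variable B_ : nat -> bop H.
Hypothesis B_0 : B_ 0%N = 0.
Hypothesis B_S : forall n, B_ n.+1 = 2^-1 *: (A + B_ n * B_ n).

Lemma norm_half (V : normedModType R[i]) (x : V) : `|2^-1 *: x| = 2^-1 * `|x|.
Proof. by rewrite normrZ ger0_norm. Qed.

Lemma sqrt_iterate_bound n x : `|B_ n x| <= q * `|x|.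
Proof.
elim: n x => [|n IHn] x; first by rewrite B_0 normr0 mulr_ge0.
rewrite B_S bopZE norm_half mulrC ler_pdivrMr// mulr_natr mulr2n.
rewrite bopDE (le_trans (ler_normD _ _))// lerD// bopME (le_trans (IHn _))//.
apply: le_trans (ler_wpM2l q0 (IHn x)) _.
by rewrite ler_wpM2l// ler_piMl// ltW.
Qed.

Lemma sqrt_iterate_step n x : `|B_ n.+1 x - B_ n x| <= q ^+ n * `|x|.
Proof.
elim: n x => [|n IHn] x.
  rewrite B_0 subr0 expr0 mul1r; apply: le_trans (sqrt_iterate_bound 1 x) _.
  by rewrite ler_piMl// ltW.
rewrite (B_S n.+1) {3}(B_S n) !bopZE -scalerBr norm_half.
rewrite mulrC ler_pdivrMr// mulr_natr mulr2n !bopDE !bopME.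
rewrite opprD addrACA subrr add0r.
(* B^2 - C^2 = B (B - C) + (B - C) C, for consecutive iterates B and C. *)
rewrite -(subrKA (B_ n.+1 (B_ n x))) addrC -bopBr exprS.
apply: le_trans (ler_normD _ _) (lerD _ _).
  apply: le_trans (IHn _) _.
  by rewrite [q * _]mulrC -mulrA ler_wpM2l ?exprn_ge0// sqrt_iterate_bound.
apply: le_trans (sqrt_iterate_bound _ _) _.
by rewrite -mulrA ler_wpM2l.
Qed.

Lemma sqrt_iterate_cauchy n k x :
  `|B_ (n + k)%N x - B_ n x| <= (1 - q)^-1 * `|x| * q ^+ n.
Proof.
have q10 : 0 < 1 - q by rewrite subr_gt0.
(* Sum the steps as a telescoping geometric series. *)
suff : `|B_ (n + k)%N x - B_ n x| * (1 - q) <= (q ^+ n - q ^+ (n + k)) * `|x|.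
  rewrite -ler_pdivlMr// => /le_trans; apply.
  rewrite [leLHS]mulrC -[leRHS]mulrA ler_wpM2l ?invr_ge0 ?(ltW q10)//.
  by rewrite [leRHS]mulrC ler_wpM2r// gerBl exprn_ge0.
elim: k => [|k IHk]; first by rewrite addn0 !subrr normr0 !mul0r.
rewrite addnS -(subrKA (B_ (n + k)%N x)).
rewrite addrC (le_trans (ler_wpM2r (ltW q10) (ler_normD _ _)))// mulrDl.
apply: le_trans (lerD IHk (ler_wpM2r (ltW q10) (sqrt_iterate_step _ _))) _.
by rewrite le_eqVlt; apply/orP; left; apply/eqP; rewrite exprS; ring.
Qed.

Lemma sqrt_iterate_limit : exists2 L : bop H, is_adj L L &
  L = 2^-1 *: (A + L * L) /\ forall x, `|L x| <= q * `|x|.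
Proof.
have q10 : 0 <= (1 - q)^-1 by rewrite invr_ge0 subr_ge0 ltW.
set C := (1 - q)^-1 in q10.
have Cx0 x : 0 <= C * `|x| by rewrite mulr_ge0.
have /choice[f fB] :
    forall x, exists l, forall n, `|l - B_ n x| <= C * `|x| * q ^+ n.
  move=> x; apply: (geometric_cauchy_limit (Cx0 x) q0 q1) => n k.
  exact: sqrt_iterate_cauchy.
have fq x : `|f x| <= q * `|x|.
  apply: (le_of_geometric_error (Cx0 x) q0 q1) => n.
  rewrite -(subrK (B_ n x) (f x)) addrC.
  apply: le_trans (ler_normD _ _) (lerD _ _) => //.
  exact: sqrt_iterate_bound.
have flin : linear f.
  move=> a x y; apply/eqP; rewrite -subr_eq0; apply/eqP.
  pose D := C * `|a *: x + y| + (`|a| * (C * `|x|) + C * `|y|).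
  have D0 : 0 <= D by rewrite !addr_ge0// mulr_ge0.
  apply: (eq0_of_geometric_error D0 q0 q1) => n.
  have -> : f (a *: x + y) - (a *: f x + f y) =
      (f (a *: x + y) - B_ n (a *: x + y)) -
      (a *: (f x - B_ n x) + (f y - B_ n y)).
    rewrite bop_linear scalerBr [X in _ = _ - X]addrACA -opprD.
    by rewrite opprB subrKA.
  apply: le_trans (ler_normB _ _) _; rewrite mulrDl lerD//.
  apply: le_trans (ler_normD _ _) _; rewrite mulrDl lerD//.
  by rewrite normrZ -mulrA ler_wpM2l.
have fbound : f \in bounded_operator.
  by apply/bounded_operatorP; split=> //; exists q.
pose L := Bop fbound.
have LB x n : `|L x - B_ n x| <= C * `|x| * q ^+ n by exact: fB.
have adjB n : is_adj (B_ n) (B_ n).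
  elim: n => [|n IHn]; first by rewrite B_0; exact: is_adj0.
  rewrite B_S; have {2}-> : 2^-1 = ((2^-1)^*)%R :> R[i].
    by apply/esym/CrealP; rewrite realV.
  by apply/is_adjZ/is_adjD => //; exact: is_adjM.
exists L; last split => //.
  move=> x y; apply/eqP; rewrite -subr_eq0; apply/eqP.
  pose D := C * `|x| * `|y| + `|x| * (C * `|y|).
  have D0 : 0 <= D by rewrite addr_ge0 ?mulr_ge0.
  apply: (eq0_of_geometric_error D0 q0 q1) => n.
  have -> : '[L x, y] - '[x, L y] = '[L x - B_ n x, y] - '[x, L y - B_ n y].
    by rewrite hdotBl hdotBr (adjB n x y) opprB subrKA.
  apply: le_trans (ler_normB _ _) _; rewrite mulrDl.
  apply: lerD; apply: le_trans (cauchy_schwarz _ _) _.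
    by rewrite mulrAC ler_wpM2r.
  by rewrite -mulrA ler_wpM2l.
apply: bopP => x; apply/eqP; rewrite -subr_eq0; apply/eqP.
pose D := C * `|x| + (C * `|L x| + C * `|x|).
have D0 : 0 <= D by rewrite !addr_ge0// mulr_ge0.
apply: (eq0_of_geometric_error D0 q0 q1) => n.
have -> : L x - (2^-1 *: (A + L * L)) x = (L x - B_ n.+1 x) -
    2^-1 *: ((L (L x) - B_ n (L x)) + B_ n (L x - B_ n x)).
  rewrite bopBr subrKA B_S !bopZE !bopDE !bopME -addrA; congr (_ + _).
  rewrite -opprD -scalerDr; congr (- (_ *: _)).
  by rewrite [RHS]addrC [A x + B_ n _]addrC subrKA addrC.
apply: le_trans (ler_normB _ _) _; rewrite norm_half mulrDl; apply: lerD.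
  apply: le_trans (LB _ _) _; rewrite ler_wpM2l// exprS ler_piMl ?exprn_ge0//.
  exact: ltW.
rewrite mulrC ler_pdivrMr// (le_trans (ler_normD _ _))//.
rewrite mulr_natr mulr2n -[leLHS]addr0 lerD//; last first.
  by rewrite mulr_ge0 ?exprn_ge0 ?addr_ge0.
rewrite mulrDl lerD//; apply: le_trans (sqrt_iterate_bound _ _) _.
by apply: le_trans (ler_piMl _ (ltW q1)) _.
Qed.

End Iteration.

(** If d <= K <= M0 and M = M0 + d, then A = 1 - M^-1 K satisfies 0 <= A <= q with
    q = M0 / M < 1, so the iteration provides a square root 1 - L of M^-1 K; its
    multiple by the square root of M is the operator sought. It is strictly
    positive since |L| <= q < 1. *)
Lemma posdef_sqrt K : posdef K -> exists S, posdef S /\ S * S = K.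
Proof.
move=> pK; have adjK := posdef_selfadj pK.
have [d d0 Kd] := posdef_lower_bound pK; have [M0 M00 KM0] := bop_bound K.
pose M := M0 + d; have Mgt0 : 0 < M by rewrite addr_gt0.
have MR : ((M^-1)^*)%R = M^-1 by apply/CrealP; rewrite realV gtr0_real.
pose q := M0 / M; have q0 : 0 < q by rewrite divr_gt0.
have q1 : q < 1 by rewrite ltr_pdivrMr// mul1r ltrDl.
pose A := 1 - M^-1 *: K.
have adjA : is_adj A A.
  apply: is_adjD; first exact: is_adj1.
  by apply: is_adjN; rewrite -{2}MR; exact: is_adjZ.
have dA x : '[A x, x] = `|x| ^+ 2 - M^-1 * '[K x, x].
  by rewrite bopBE bopZE hdotBl hdotZl hdot_norm.
have Aq : forall x, `|A x| <= q * `|x|.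
  apply: numerical_radius_bound => // x.
  have Kx0 := posdef_ge0 x pK.
  have KxM : '[K x, x] <= M0 * `|x| ^+ 2.
    rewrite -(ger0_norm Kx0) (le_trans (cauchy_schwarz _ _))// expr2 mulrA.
    by rewrite ler_wpM2r.
  rewrite dA ger0_norm; last first.
    rewrite subr_ge0 mulrC ler_pdivrMr// mulrC (le_trans KxM)//.
    by rewrite ler_wpM2r ?exprn_ge0// lerDl ltW.
  rewrite lerBlDr.
  rewrite -[leLHS]mul1r -(mulVf (lt0r_neq0 Mgt0)) {2}/M mulrDr mulrDl lerD//.
    by rewrite [M^-1 * _]mulrC.
  by rewrite -mulrA ler_wpM2l// invr_ge0 ltW.
pose B_ n : bop H := iter n (fun B => 2^-1 *: (A + B * B)) 0.
have [L adjL [LE Lq]] := sqrt_iterate_limit (B_ := B_) adjA (ltW q0) q1 Aq erefl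
  (fun _ => erefl).
have LL : (1 - L) * (1 - L) = M^-1 *: K.
  have AE : A = L + L - L * L.
    apply/eqP; rewrite eq_sym subr_eq -[in L + L](scale1r L).
    rewrite -scalerDl {1}LE scalerA.
    have -> : (1 + 1) * 2^-1 = 1 :> R[i].
      by rewrite -[1 + 1]/(2%:R) mulfV ?pnatr_eq0.
    by rewrite scale1r.
  have -> : M^-1 *: K = 1 - A by rewrite /A subKr.
  rewrite AE mulrBl mul1r mulrBr mulr1.
  by rewrite -[in RHS](addrA L L) [in RHS]opprD addrA.
have [_ [B KB]] := pK.
pose s := sqrtC M; have s0 : 0 < s by rewrite sqrtC_gt0.
have SS : (s *: (1 - L)) * (s *: (1 - L)) = K.
  rewrite -bop_scalerAl -bop_scalerAr LL !scalerA -expr2 sqrtCK.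
  by rewrite mulfV ?scale1r// gt_eqF.
exists (s *: (1 - L)); split=> //; split; last first.
  by exists (s *: (1 - L) * B); exact: two_sided_inverse_sqrt SS KB.
move=> x x0; rewrite bopZE hdotZl mulr_gt0// bopBE hdotBl hdot_norm subr_gt0.
have /real_ler_norm/le_lt_trans -> // := selfadj_real adjL x.
rewrite (le_lt_trans (cauchy_schwarz _ _))// expr2 ltr_pM2r ?normr_gt0//.
by rewrite (le_lt_trans (Lq x))// gtr_pMl ?normr_gt0.
Qed.

End SquareRoot.
(** * Inverses of bordered matrices *)

Lemma big_ord_recr_lift (V : nmodType) n (F : 'I_n.+1 -> V) :
  \sum_i F i = \sum_(i < n) F (lift ord_max i) + F ord_max.
Proof.
rewrite big_ord_recr; congr (_ + _); apply: eq_bigr => i _; congr (F _).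
by apply: val_inj; rewrite [RHS]lift_max.
Qed.

Section SchurComplement.
Context {S : pzRingType} {n : nat}.
Variables (T X : 'M[S]_n.+1) (B : 'M[S]_n).

Definition corner (Y : 'M[S]_n.+1) : 'M[S]_n :=
  \matrix_(i, j) Y (lift ord_max i) (lift ord_max j).

Definition last_col (Y : 'M[S]_n.+1) : 'cV[S]_n :=
  \col_i Y (lift ord_max i) ord_max.

Definition last_row (Y : 'M[S]_n.+1) : 'rV[S]_n :=
  \row_j Y ord_max (lift ord_max j).

Definition schur_complement : S :=
  T ord_max ord_max - (last_row T *m B *m last_col T) 0 0.

(** The column and the row of the rank-one correction in the inverse of T, when
    B is the inverse of the corner. *)
Definition schur_col (k : 'I_n.+1) : S :=
  if unlift ord_max k is Some i then - (B *m last_col T) i 0 else 1.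
Definition schur_row (k : 'I_n.+1) : S :=
  if unlift ord_max k is Some j then - (last_row T *m B) 0 j else 1.

Definition pad (k l : 'I_n.+1) : S :=
  if unlift ord_max k is Some i then
    if unlift ord_max l is Some j then B i j else 0 else 0.

Lemma corner_mul (Y Z : 'M[S]_n.+1) :
  corner (Y *m Z) = corner Y *m corner Z + last_col Y *m last_row Z.
Proof.
apply/matrixP => i j; rewrite !mxE big_ord_recr_lift big_ord1 !mxE.
by congr (_ + _); apply: eq_bigr => k _; rewrite !mxE.
Qed.

(** Scalars enter the block identities as 1 x 1 matrices, since the ring is not
    commutative and a column is to be multiplied on its right. *)
Lemma last_col_mul (Y Z : 'M[S]_n.+1) : last_col (Y *m Z) =
  corner Y *m last_col Z + last_col Y *m (Z ord_max ord_max)%:M.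
Proof.
apply/matrixP => i j; rewrite !mxE big_ord_recr_lift big_ord1 !mxE ord1 eqxx.
by congr (_ + _); apply: eq_bigr => k _; rewrite !mxE.
Qed.

Lemma last_row_mul (Y Z : 'M[S]_n.+1) : last_row (Y *m Z) =
  last_row Y *m corner Z + (Y ord_max ord_max)%:M *m last_row Z.
Proof.
apply/matrixP => i j; rewrite !mxE big_ord_recr_lift big_ord1 !mxE ord1 eqxx.
by congr (_ + _); apply: eq_bigr => k _; rewrite !mxE.
Qed.

Lemma last_entry_mul (Y Z : 'M[S]_n.+1) : ((Y *m Z) ord_max ord_max)%:M =
  last_row Y *m last_col Z +
  (Y ord_max ord_max)%:M *m (Z ord_max ord_max)%:M :> 'M[S]_1.
Proof.
apply/matrixP => i j; rewrite !mxE big_ord_recr_lift big_ord1 !mxE !ord1 eqxx.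
by rewrite !mulr1n; congr (_ + _); apply: eq_bigr => k _; rewrite !mxE.
Qed.

Lemma corner1 : corner 1%:M = 1%:M.
Proof. by apply/matrixP => i j; rewrite !mxE (inj_eq lift_inj). Qed.

Lemma last_col1 : last_col 1%:M = 0.
Proof. by apply/matrixP => i j; rewrite !mxE eq_sym (negPf (neq_lift _ _)). Qed.

Lemma last_row1 : last_row 1%:M = 0.
Proof. by apply/matrixP => i j; rewrite !mxE (negPf (neq_lift _ _)). Qed.

Hypotheses (TX : two_sided_inverse T X) (AB : two_sided_inverse (corner T) B).

Let s := X ord_max ord_max.

Lemma schur_complementE : schur_complement%:M =
  (T ord_max ord_max)%:M - last_row T *m B *m last_col T :> 'M[S]_1.
Proof.
apply/matrixP=> i j; rewrite !ord1 mxE eqxx mulr1n.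
by rewrite [RHS]mxE [X in X + _]mxE eqxx mulr1n [X in _ + X]mxE.
Qed.

Lemma inverse_last_col : last_col X = - (B *m last_col T *m s%:M).
Proof.
have TX1 : T *m X = 1%:M by case: TX.
have BA : B *m corner T = 1%:M by case: AB.
have := congr1 last_col TX1; rewrite last_col_mul last_col1 => /addr0_eq eqX.
by rewrite -mulmxA -eqX mulmxN opprK mulmxA BA mul1mx.
Qed.

Lemma inverse_last_row : last_row X = - (s%:M *m (last_row T *m B)).
Proof.
have XT1 : X *m T = 1%:M by case: TX.
have BA : corner T *m B = 1%:M by case: AB.
have := congr1 last_row XT1; rewrite last_row_mul last_row1 => /addr0_eq eqX.
by rewrite mulmxA -eqX mulNmx opprK -mulmxA BA mulmx1.
Qed.

(** The last entry s of the inverse inverts the Schur complement: eliminate the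
    last column of X from T X = 1, and its last row from X T = 1. *)
Lemma schur_complement_inverse : two_sided_inverse schur_complement s.
Proof.
have TX1 : T *m X = 1%:M by case: TX.
have XT1 : X *m T = 1%:M by case: TX.
have m1 (x y : S) : x%:M = y%:M :> 'M[S]_1 -> x = y.
  by move=> /matrixP/(_ 0 0); rewrite !mxE !mulr1n.
split; apply: m1; rewrite scalar_mxM schur_complementE.
  have := last_entry_mul T X.
  rewrite TX1 mxE eqxx mulr1n inverse_last_col => ->.
  by rewrite mulmxN mulmxBl addrC -!mulmxA.
have := last_entry_mul X T.
rewrite XT1 mxE eqxx mulr1n inverse_last_row => ->.
by rewrite mulNmx mulmxBr addrC -!mulmxA.
Qed.

Lemma inverse_corner :
  corner X = B + B *m last_col T *m s%:M *m (last_row T *m B).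
Proof.
have TX1 : T *m X = 1%:M by case: TX.
have BA : B *m corner T = 1%:M by case: AB.
have := congr1 corner TX1; rewrite corner_mul corner1 => /(congr1 (mulmx B)).
rewrite mulmxDr mulmx1 mulmxA BA mul1mx inverse_last_row.
by move=> /(canRL (addrK _)) ->; rewrite !mulmxN opprK !mulmxA.
Qed.

(** The borders of the inverse are multiples of its last entry, which is the
    inverse Schur complement; substituting them in the equation for the corner
    leaves a rank-one correction of B. *)
Lemma inverse_entries k l :
  X k l = pad k l + schur_col k * rinv schur_complement * schur_row l.
Proof.
rewrite (rinvE schur_complement_inverse) /pad /schur_col /schur_row.
case: unliftP => [i ->|->]; case: unliftP => [j ->|->].
- have /matrixP/(_ i j) := inverse_corner; rewrite [LHS]mxE => ->.
  rewrite [LHS]mxE !mulNr mulrN opprK; congr (_ + _).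
  rewrite mxE big_ord1; congr (_ * _); rewrite mxE big_ord1; congr (_ * _).
  by rewrite mxE eqxx mulr1n.
- have /matrixP/(_ i 0) := inverse_last_col; rewrite [LHS]mxE => ->.
  rewrite add0r mulr1 mulNr mxE; congr (- _).
  by rewrite mxE big_ord1; congr (_ * _); rewrite mxE eqxx mulr1n.
- have /matrixP/(_ 0 j) := inverse_last_row; rewrite [LHS]mxE => ->.
  rewrite add0r mul1r mulrN mxE; congr (- _).
  by rewrite mxE big_ord1; congr (_ * _); rewrite mxE eqxx mulr1n.
- by rewrite add0r mul1r mulr1.
Qed.

End SchurComplement.

(** * Positive definite operator matrices *)

Section OperatorMatrices.
Context {R : realType} {H : hilbertType R}.

Lemma posdefmx_hdotv_ge0 n (T : 'M[bop H]_n) x :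
  posdefmx T -> 0 <= hdotv (mxact T x) x.
Proof.
case=> Tp _; have [->|x0] := eqVneq x 0; last exact/ltW/Tp.
by rewrite /hdotv big1// => i _; rewrite [X in '[_, X]]mxE hdot0r.
Qed.

(** Positivity makes the form of T on H^n real on the diagonal, hence hermitian;
    evaluating it at vectors with one nonzero component gives the entries. *)
Lemma posdefmx_selfadj n (T : 'M[bop H]_n) :
  posdefmx T -> forall i j, is_adj (T i j) (T j i).
Proof.
move=> pT i j u v.
(* The vectors are finite functions, which form a module over R[i]. *)
pose f (x y : {ffun 'I_n -> H}) : R[i] := \sum_k \sum_l '[T k l (x l), y k].
pose single k w : {ffun 'I_n -> H} := [ffun l => if l == k then w else 0].
have f_single k l w z : f (single l w) (single k z) = '[T k l w, z].
  rewrite /f (bigD1 k)//= (bigD1 l)//= !ffunE !eqxx !big1 ?addr0//.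
    by move=> m /negPf mk; rewrite !ffunE mk big1// => p _; rewrite hdot0r.
  move=> m /negPf ml; rewrite ffunE ml.
  by rewrite -[0](scale0r (0 : H)) bopZr scale0r hdot0l.
rewrite -f_single [RHS]hdotC -f_single.
apply: hermitian_of_real_diagonal.
- move=> x y z; rewrite /f -big_split; apply: eq_bigr => k _ /=.
  by rewrite -big_split; apply: eq_bigr => l _; rewrite ffunE bopDr hdotDl.
- move=> x y z; rewrite /f -big_split; apply: eq_bigr => k _ /=.
  by rewrite -big_split; apply: eq_bigr => l _; rewrite ffunE hdotDr.
- move=> a x y; rewrite /f mulr_sumr; apply: eq_bigr => k _ /=.
  by rewrite mulr_sumr; apply: eq_bigr => l _; rewrite ffunE bopZr hdotZl.
- move=> a x y; rewrite /f mulr_sumr; apply: eq_bigr => k _ /=.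
  by rewrite mulr_sumr; apply: eq_bigr => l _; rewrite ffunE hdotZr.
move=> x; apply: ger0_real.
suff -> : f x x = hdotv (mxact T (\col_k x k)) (\col_k x k).
  exact: posdefmx_hdotv_ge0.
apply: eq_bigr => k _; rewrite !mxE hdot_suml; apply: eq_bigr => l _.
by rewrite mxE.
Qed.

(** The usual <X x, y> = <X x, T X y> = <T X x, X y> = <x, X y>, for vectors x and
    y of H^n with one nonzero component. *)
Lemma inverse_is_adj n (T X : 'M[bop H]_n) :
  (forall i j, is_adj (T i j) (T j i)) -> two_sided_inverse T X ->
  forall i j, is_adj (X i j) (X j i).
Proof.
move=> adjT [TX XT] i j x y.
have TXx k l (u : H) : \sum_m T k m (X m l u) = (1%:M : 'M[bop H]_n) k l u.
  by rewrite -[1%:M]TX mxE bop_sumE.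
have e (k l : 'I_n) (u : H) :
    (1%:M : 'M[bop H]_n) k l u = if k == l then u else 0.
  by rewrite mxE; case: eqP.
have -> : '[X i j x, y] = \sum_k '[X k j x, (1%:M : 'M[bop H]_n) k i y].
  rewrite (bigD1 i)//= e eqxx big1 ?addr0// => k /negPf ki.
  by rewrite e ki hdot0r.
have -> : '[x, X j i y] = \sum_k '[(1%:M : 'M[bop H]_n) k j x, X k i y].
  rewrite (bigD1 j)//= e eqxx big1 ?addr0// => k /negPf ki.
  by rewrite e ki hdot0l.
under eq_bigr => k _ do rewrite -TXx hdot_sumr.
under [RHS]eq_bigr => k _ do rewrite -TXx hdot_suml.
rewrite exchange_big; apply: eq_bigr => k _; apply: eq_bigr => l _.
by rewrite adjT.
Qed.

Definition adjmx_pair m n (A : 'M[bop H]_(m, n)) (B : 'M[bop H]_(n, m)) :=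
  forall i j, is_adj (A i j) (B j i).

Lemma adjmxE m n (A : 'M[bop H]_(m, n)) B : adjmx_pair A B -> adjmx A = B.
Proof. by move=> AB; apply/matrixP => i j; rewrite !mxE; apply: is_adjE. Qed.

Lemma adjmx_pair_mul m n p (A : 'M[bop H]_(m, n)) A' (B : 'M[bop H]_(n, p)) B' :
  adjmx_pair A A' -> adjmx_pair B B' -> adjmx_pair (A *m B) (B' *m A').
Proof.
by move=> AA BB i j; rewrite !mxE; apply: is_adj_sum => k; apply: is_adjM.
Qed.

Lemma posdefmx_rinv m (Y : 'M[bop H]_m) :
  posdefmx Y -> two_sided_inverse Y (rinv Y).
Proof. by case=> _ [Z /rinvP]. Qed.

Lemma posdefmx_rinv_adj m (Y : 'M[bop H]_m) :
  posdefmx Y -> adjmx_pair (rinv Y) (rinv Y).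
Proof.
by move=> pY; apply: inverse_is_adj (posdefmx_rinv pY); apply: posdefmx_selfadj.
Qed.

(** The expression [zrow _ _ *m X *m zcol _ _] with arbitrary scalars in place of
    the powers, as needed for powers in decreasing order. *)
Definition bform n (X : 'M[bop H]_n) (a b : 'I_n -> R[i]) : bop H :=
  \sum_i \sum_j (a i * b j) *: X i j.

Section HermitianSchur.
Context {n : nat} {T : 'M[bop H]_n.+1}.
Hypotheses (pT : posdefmx T) (pA : posdefmx (corner T)).

Let B := rinv (corner T).
Local Notation P := (schur_col T B).
Local Notation Q := (schur_row T B).
Local Notation kappa := (schur_complement T B).
Let sigma := rinv (op_sqrt kappa).

Lemma last_col_adj : adjmx_pair (last_col T) (last_row T).
Proof. by move=> i j; rewrite !mxE; apply: posdefmx_selfadj. Qed.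

Lemma schur_col_adj k : is_adj (P k) (Q k).
Proof.
rewrite /schur_col /schur_row; case: unlift => [i|]; last exact: is_adj1.
apply: is_adjN; apply: adjmx_pair_mul last_col_adj i 0.
exact: posdefmx_rinv_adj.
Qed.

(** Block elimination: p is the vector with last entry 1 that all rows of T but
    the last annihilate. *)
Lemma mul_schur_col i :
  \sum_j T i j * P j = if i == ord_max then kappa else 0.
Proof.
have AB : corner T *m B = 1%:M by case: (posdefmx_rinv pA).
rewrite big_ord_recr_lift {2}/schur_col unlift_none mulr1.
under eq_bigr => j _ do rewrite /schur_col liftK mulrN.
rewrite sumrN addrC; case: eqP => [->|/eqP i_max].
  rewrite /schur_complement -mulmxA mxE.
  by congr (_ - _); apply: eq_bigr => j _; rewrite [last_row _ _ _]mxE.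
case: (unliftP ord_max i) i_max => [k ->|-> /eqP//] _.
have -> : T (lift ord_max k) ord_max = (corner T *m (B *m last_col T)) k 0.
  by rewrite mulmxA AB mul1mx mxE.
rewrite mxE; apply/eqP; rewrite subr_eq0; apply/eqP/eq_bigr => j _.
by rewrite [corner _ _ _]mxE.
Qed.

(** The form of kappa at x is that of T at the vector p x, whose last component
    is x. *)
Lemma schur_complement_posdef : posdef kappa.
Proof.
split; last first.
  exists (rinv T ord_max ord_max).
  exact: schur_complement_inverse (posdefmx_rinv pT) (posdefmx_rinv pA).
move=> x x0; pose v : 'cV[H]_n.+1 := \col_k P k x.
have v0 : v != 0.
  apply: contra_neq x0 => /matrixP/(_ ord_max 0); rewrite !mxE /schur_col.
  by rewrite unlift_none bop1E.
have [/(_ v v0) + _] := pT; rewrite /hdotv.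
have Tv i : mxact T v i 0 = (if i == ord_max then kappa else 0) x.
  by rewrite -mul_schur_col bop_sumE mxE; apply: eq_bigr => j _; rewrite mxE.
rewrite (bigD1 ord_max)//= Tv eqxx big1 => [|i /negPf i_max]; last first.
  by rewrite Tv i_max hdot0l.
by rewrite addr0 mxE /schur_col unlift_none bop1E.
Qed.

(** The two properties through which the normalization of the polynomials
    enters; they hold for the inverse of every positive definite square root. *)
Lemma rinv_sqrt_schur : is_adj sigma sigma /\ sigma * sigma = rinv kappa.
Proof.
have pk := schur_complement_posdef.
have [S SP] := posdef_sqrt pk.
have [pS SS] : posdef (op_sqrt kappa) /\ op_sqrt kappa * op_sqrt kappa = kappa.
  by rewrite /op_sqrt; case: xgetP => [Z _ //|/(_ S)[]].
rewrite /sigma; move: (op_sqrt kappa) pS SS => r pr rr.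
have [_ [Y rY]] := pr; have rV := rinvP rY.
split; first exact: (is_adj_inv (posdef_selfadj pr) rV rV).
apply/esym/rinvE; have [rr1 r1r] := rV; rewrite -rr; split.
  by rewrite mulrA -(mulrA r) rr1 mulr1.
by rewrite mulrA -(mulrA (rinv r)) r1r mulr1.
Qed.

(** [inverse_entries] for bilinear forms, the inverse Schur complement being
    distributed evenly over the two factors as the square of sigma. *)
Lemma bform_schur (a b : 'I_n.+1 -> R[i]) :
  bform (rinv T) a b = bform B (a \o lift ord_max) (b \o lift ord_max) +
    (\sum_k a k *: (P k * sigma)) * (\sum_k b k *: (sigma * Q k)).
Proof.
have TX := posdefmx_rinv pT; have AB := posdefmx_rinv pA.
have -> : bform B (a \o lift ord_max) (b \o lift ord_max) =
    \sum_i \sum_j (a i * b j) *: pad B i j.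
  rewrite big_ord_recr_lift [X in _ + X]big1 ?addr0; last first.
    by move=> j _; rewrite /pad unlift_none scaler0.
  apply: eq_bigr => i _; rewrite big_ord_recr_lift {2}/pad liftK unlift_none.
  rewrite scaler0 addr0; apply: eq_bigr => j _.
  by rewrite /pad !liftK.
rewrite mulr_suml -big_split; apply: eq_bigr => k _ /=.
rewrite mulr_sumr -big_split; apply: eq_bigr => l _ /=.
rewrite (inverse_entries TX AB) scalerDr; congr (_ + _).
by rewrite -bop_scalerAl -bop_scalerAr scalerA -(proj2 rinv_sqrt_schur) !mulrA.
Qed.

End HermitianSchur.

End OperatorMatrices.

(** * Operator polynomials *)

Section Polynomials.
Context {R : realType} {H : hilbertType R}.
Implicit Types z w s t : R[i].

Lemma adj_peval n (F F' : oppoly (H := H) n) z :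
  (forall k, is_adj (F k) (F' k)) ->
  adj (peval F z) = \sum_(k < n.+1) ((z^*)%R ^+ k) *: F' k.
Proof.
move=> FF'; apply/is_adjE/is_adj_sum => k; rewrite -rmorphXn.
exact: is_adjZ.
Qed.

(** Both branches of the definition of [reversed] are values of the polynomial
    with adjoint coefficients in reversed order. *)
Lemma reversedE n (F F' : oppoly (H := H) n) z :
  (forall k, is_adj (F k) (F' k)) ->
  reversed F z = \sum_(k < n.+1) z ^+ (n - k) *: F' k.
Proof.
move=> FF'; rewrite /reversed; have [->|z0] := eqVneq z 0.
  (* At 0 only the term k = n survives, as 0 ^+ 0 = 1. *)
  rewrite (is_adjE (FF' _)) (bigD1 ord_max)//= subnn expr0 scale1r.
  rewrite big1 ?addr0// => k k_max; rewrite expr0n subn_eq0.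
  by rewrite leqNgt ltn_neqAle -ltnS ltn_ord k_max scale0r.
rewrite (adj_peval _ FF') scaler_sumr; apply: eq_bigr => k _.
rewrite scalerA; congr (_ *: _).
by rewrite fmorphV /= conjCK exprVn -exprB ?unitfE// -ltnS ltn_ord.
Qed.

Lemma adj_reversed n (F F' : oppoly (H := H) n) z :
  (forall k, is_adj (F k) (F' k)) ->
  adj (reversed F z) = \sum_(k < n.+1) (z^*)%R ^+ (n - k) *: F k.
Proof.
move=> FF'; rewrite (reversedE _ FF'); apply/is_adjE/is_adj_sum => k.
by rewrite -rmorphXn; apply/is_adjZ/is_adj_sym.
Qed.

Lemma zrow_mul_zcol n (X : 'M[bop H]_n) z w :
  (zrow n z *m X *m zcol n w) 0 0 =
  bform X (fun i => z ^+ i) (fun j => w ^+ j).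
Proof.
rewrite mxE /bform exchange_big; apply: eq_bigr => j _.
rewrite mxE mulr_suml; apply: eq_bigr => i _; rewrite !mxE.
by rewrite -bop_scalerAl mul1r -bop_scalerAr mulr1 scalerA mulrC.
Qed.

Lemma eq_bform n (X : 'M[bop H]_n) a b a' b' : a =1 a' -> b =1 b' ->
  bform X a b = bform X a' b'.
Proof.
by move=> aa bb; apply: eq_bigr => i _; apply: eq_bigr => j _; rewrite aa bb.
Qed.

Lemma bformZ n (X : 'M[bop H]_n) s t a b :
  bform X (fun i => s * a i) (fun j => t * b j) = (s * t) *: bform X a b.
Proof.
rewrite scaler_sumr; apply: eq_bigr => i _; rewrite scaler_sumr.
by apply: eq_bigr => j _; rewrite scalerA mulrACA.
Qed.

End Polynomials.

Definition flipmx (S : pzRingType) n (X : 'M[S]_n) : 'M[S]_n :=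
  \matrix_(i, j) X (rev_ord i) (rev_ord j).

Lemma flipmx_mul (S : pzRingType) n (X Y : 'M[S]_n) :
  flipmx (X *m Y) = flipmx X *m flipmx Y.
Proof.
apply/matrixP => i j; rewrite !mxE (reindex_inj rev_ord_inj).
by apply: eq_bigr => k _; rewrite !mxE.
Qed.

Lemma flipmx_inverse (S : pzRingType) n (X Y : 'M[S]_n) :
  two_sided_inverse X Y -> two_sided_inverse (flipmx X) (flipmx Y).
Proof.
have f1 : flipmx 1%:M = 1%:M :> 'M[S]_n.
  by apply/matrixP => i j; rewrite !mxE (inj_eq rev_ord_inj).
case=> XY YX; split.
  by rewrite -[RHS]f1 -[1%:M]XY flipmx_mul.
by rewrite -[RHS]f1 -[1%:M]YX flipmx_mul.
Qed.

Lemma bform_flipmx (R : realType) (H : hilbertType R) n (X : 'M[bop H]_n) a b :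
  bform (flipmx X) a b = bform X (a \o @rev_ord n) (b \o @rev_ord n).
Proof.
rewrite /bform (reindex_inj rev_ord_inj); apply: eq_bigr => i _.
rewrite (reindex_inj rev_ord_inj); apply: eq_bigr => j _.
by rewrite mxE !rev_ordK.
Qed.

(** * Toeplitz matrices and kernel polynomials *)

Section ToeplitzMatrices.
Context {R : realType} {H : hilbertType R} (mu : povm H).
Implicit Types z w : R[i].
Hypothesis nontrivial : povm_nontrivial mu.

(** The empty matrix is the base of the induction on the size. *)
Lemma posdefmx0 (T : 'M[bop H]_0) : posdefmx T.
Proof.
split=> [x /eqP[]|]; first exact: flatmx0.
by exists T; split; apply/matrixP; case.
Qed.

Lemma posdefmx_TR n : posdefmx (TR mu n).
Proof.
by case: n => [|n]; [exact: posdefmx0|case: (nontrivial (ltn0Sn n))].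
Qed.

Lemma posdefmx_TL n : posdefmx (TL mu n).
Proof.
by case: n => [|n]; [exact: posdefmx0|case: (nontrivial (ltn0Sn n))].
Qed.

Lemma corner_TR n : corner (TR mu n.+1) = TR mu n.
Proof. by apply/matrixP => i j; rewrite !mxE !lift_max. Qed.

Lemma corner_TL n : corner (TL mu n.+1) = TL mu n.
Proof. by apply/matrixP => i j; rewrite !mxE !lift_max. Qed.

Lemma last_col_TR n : last_col (TR mu n.+1) = nu mu n.
Proof. by apply/matrixP => i j; rewrite !mxE lift_max. Qed.

Lemma last_col_TL n : last_col (TL mu n.+1) = xi mu n.
Proof. by apply/matrixP => i j; rewrite !mxE lift_max. Qed.

Lemma last_row_TR n : last_row (TR mu n.+1) = adjmx (nu mu n).
Proof.
by rewrite -last_col_TR; apply/esym/adjmxE/last_col_adj/posdefmx_TR.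
Qed.

Lemma last_row_TL n : last_row (TL mu n.+1) = adjmx (xi mu n).
Proof.
by rewrite -last_col_TL; apply/esym/adjmxE/last_col_adj/posdefmx_TL.
Qed.

(** (n - 1 - i) - (n - 1 - j) = j - i. *)
Lemma TL_flip n : TL mu n = flipmx (TR mu n).
Proof.
apply/matrixP => i j; rewrite !mxE; congr (moment mu _) => /=.
rewrite -!subzn ?ltn_ord//; lia.
Qed.

Lemma rinv_TL n : rinv (TL mu n) = flipmx (rinv (TR mu n)).
Proof.
by rewrite TL_flip; apply/rinvE/flipmx_inverse/posdefmx_rinv/posdefmx_TR.
Qed.

Lemma rinv_TR n : rinv (TR mu n) = flipmx (rinv (TL mu n)).
Proof. by rewrite rinv_TL; apply/matrixP => i j; rewrite !mxE !rev_ordK. Qed.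

Lemma kappaRE n : kappaR mu n = schur_complement (TR mu n.+1) (rinv (TR mu n)).
Proof.
by rewrite /schur_complement last_row_TR last_col_TR [TR _ _ _ _]mxE subrr.
Qed.

Lemma kappaLE n : kappaL mu n = schur_complement (TL mu n.+1) (rinv (TL mu n)).
Proof.
by rewrite /schur_complement last_row_TL last_col_TL [TL _ _ _ _]mxE subrr.
Qed.

(** The adjoints of the coefficients of the normalized polynomials, written
    without [adj]. *)
Definition phiR_adj n : oppoly (H := H) n := [ffun k =>
  rinv (op_sqrt (kappaR mu n)) * schur_row (TR mu n.+1) (rinv (TR mu n)) k].

Definition phiL_adj n : oppoly (H := H) n := [ffun k =>
  schur_col (TL mu n.+1) (rinv (TL mu n)) k * rinv (op_sqrt (kappaL mu n))].

Lemma phiRE n k : phiR mu n k =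
  schur_col (TR mu n.+1) (rinv (TR mu n)) k * rinv (op_sqrt (kappaR mu n)).
Proof. by rewrite !ffunE /schur_col last_col_TR. Qed.

Lemma phiLE n k : phiL mu n k =
  rinv (op_sqrt (kappaL mu n)) * schur_row (TL mu n.+1) (rinv (TL mu n)) k.
Proof. by rewrite !ffunE /schur_row last_row_TL. Qed.

Lemma phiR_is_adj n k : is_adj (phiR mu n k) (phiR_adj n k).
Proof.
have pT := posdefmx_TR n.+1; have pA := posdefmx_TR n; rewrite -corner_TR in pA.
rewrite phiRE ffunE kappaRE -(corner_TR n); apply: is_adjM.
  exact: (schur_col_adj pT pA).
by case: (rinv_sqrt_schur pT pA).
Qed.

Lemma phiL_is_adj n k : is_adj (phiL mu n k) (phiL_adj n k).
Proof.
have pT := posdefmx_TL n.+1; have pA := posdefmx_TL n; rewrite -corner_TL in pA.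
rewrite phiLE ffunE kappaLE -(corner_TL n); apply: is_adjM.
  by case: (rinv_sqrt_schur pT pA).
exact: is_adj_sym (schur_col_adj pT pA k).
Qed.

Lemma bform_TR n (a b : 'I_n.+1 -> R[i]) : bform (rinv (TR mu n.+1)) a b =
  bform (rinv (TR mu n)) (a \o lift ord_max) (b \o lift ord_max) +
  (\sum_k a k *: phiR mu n k) * (\sum_k b k *: phiR_adj n k).
Proof.
have pT := posdefmx_TR n.+1; have pA := posdefmx_TR n; rewrite -corner_TR in pA.
rewrite (bform_schur pT pA) corner_TR -kappaRE.
by congr (_ + _ * _); apply: eq_bigr => k _; rewrite ?phiRE// ffunE.
Qed.

Lemma bform_TL n (a b : 'I_n.+1 -> R[i]) : bform (rinv (TL mu n.+1)) a b =
  bform (rinv (TL mu n)) (a \o lift ord_max) (b \o lift ord_max) +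
  (\sum_k a k *: phiL_adj n k) * (\sum_k b k *: phiL mu n k).
Proof.
have pT := posdefmx_TL n.+1; have pA := posdefmx_TL n; rewrite -corner_TL in pA.
rewrite (bform_schur pT pA) corner_TL -kappaLE.
by congr (_ + _ * _); apply: eq_bigr => k _; rewrite ?phiLE// ffunE.
Qed.

Lemma powers_lift n (z : R[i]) :
  (fun i : 'I_n.+1 => z ^+ i) \o lift ord_max =1 (fun i : 'I_n => z ^+ i).
Proof. by move=> i; rewrite /= [bump _ _]lift_max. Qed.

Lemma bform_TR_powers n z w :
  bform (rinv (TR mu n.+1)) (fun i => z ^+ i) (fun j => (w^*)%R ^+ j) =
  bform (rinv (TR mu n)) (fun i => z ^+ i) (fun j => (w^*)%R ^+ j) +
  peval (phiR mu n) z * adj (peval (phiR mu n) w).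
Proof.
rewrite bform_TR (adj_peval _ (@phiR_is_adj n)); congr (_ + _).
by apply: eq_bform; exact: powers_lift.
Qed.

Lemma bform_TL_powers n z w :
  bform (rinv (TL mu n.+1)) (fun i => (w^*)%R ^+ i) (fun j => z ^+ j) =
  bform (rinv (TL mu n)) (fun i => (w^*)%R ^+ i) (fun j => z ^+ j) +
  adj (peval (phiL mu n) w) * peval (phiL mu n) z.
Proof.
rewrite bform_TL (adj_peval _ (@phiL_is_adj n)); congr (_ + _).
by apply: eq_bform; exact: powers_lift.
Qed.

Lemma KRE n w z : KR mu n w z =
  bform (rinv (TR mu n.+1)) (fun i => z ^+ i) (fun j => (w^*)%R ^+ j).
Proof.
rewrite /KR; elim: (n.+1) => [|m IHm]; first by rewrite /bform !big_ord0.
by rewrite big_ord_recr IHm bform_TR_powers.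
Qed.

Lemma KLE n w z : KL mu n w z =
  bform (rinv (TL mu n.+1)) (fun i => (w^*)%R ^+ i) (fun j => z ^+ j).
Proof.
rewrite /KL; elim: (n.+1) => [|m IHm]; first by rewrite /bform !big_ord0.
by rewrite big_ord_recr IHm bform_TL_powers.
Qed.

(** Restricting the reversed powers z^n, ..., z, 1 to all indices but the last
    removes the power 1, which leaves a common factor z. *)
Lemma reversed_powers n (z : R[i]) :
  ((fun i : 'I_n.+1 => z ^+ i) \o @rev_ord n.+1) \o lift ord_max =1
  fun i => z * ((fun i : 'I_n => z ^+ i) \o @rev_ord n) i.
Proof.
move=> i; rewrite /= -exprS [bump _ _]lift_max; congr (_ ^+ _).
by rewrite subSS subnSK // ltn_ord.
Qed.

(** Bordering T^R at the end means bordering the reversed matrix T^L at the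
    beginning. *)
Lemma bform_TL_reversed n z w :
  bform (rinv (TL mu n.+1)) (fun i => (w^*)%R ^+ i) (fun j => z ^+ j) =
  ((w^*)%R * z) *:
    bform (rinv (TL mu n)) (fun i => (w^*)%R ^+ i) (fun j => z ^+ j) +
  adj (reversed (phiR mu n) w) * reversed (phiR mu n) z.
Proof.
rewrite !rinv_TL !bform_flipmx bform_TR -bformZ.
rewrite (adj_reversed _ (@phiR_is_adj n)) (reversedE _ (@phiR_is_adj n)).
by congr (_ + _); apply: eq_bform; exact: reversed_powers.
Qed.

Lemma bform_TR_reversed n z w :
  bform (rinv (TR mu n.+1)) (fun i => z ^+ i) (fun j => (w^*)%R ^+ j) =
  ((w^*)%R * z) *:
    bform (rinv (TR mu n)) (fun i => z ^+ i) (fun j => (w^*)%R ^+ j) +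
  reversed (phiL mu n) z * adj (reversed (phiL mu n) w).
Proof.
rewrite !rinv_TR !bform_flipmx bform_TL [_ * z]mulrC -bformZ.
rewrite (adj_reversed _ (@phiL_is_adj n)) (reversedE _ (@phiL_is_adj n)).
by congr (_ + _); apply: eq_bform; exact: reversed_powers.
Qed.

End ToeplitzMatrices.

Lemma christoffel_darboux_solve (K : fieldType) (V : lmodType K) (c : K)
    (u v x y : V) : c != 1 -> u = c *: v + x -> u = v + y ->
  u = (1 - c)^-1 *: (x - c *: y).
Proof.
move=> c1 ux uy; have c10 : 1 - c != 0 by rewrite subr_eq0 eq_sym.
suff -> : x - c *: y = (1 - c) *: u by rewrite scalerA mulVf// scale1r.
have -> : x = u - c *: v by rewrite ux addrAC subrr add0r.
have -> : y = u - v by rewrite uy addrAC subrr add0r.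
by rewrite scalerBr opprB addrA subrK scalerBl scale1r.
Qed.

Theorem proposition5p1 (R : realType) (H : hilbertType R)
    (H_separable : separable_space H) (mu : povm H)
    (mu_ac : povm_abs_continuous mu) (mu_nontrivial : povm_nontrivial mu) :
  [/\ forall (n : nat) (w z : R[i]),
        KR mu n w z =
          (zrow n.+1 z *m rinv (TR mu n.+1) *m zcol n.+1 (w^*)%R) 0 0,
      forall (n : nat) (w z : R[i]),
        KL mu n w z =
          (zrow n.+1 (w^*)%R *m rinv (TL mu n.+1) *m zcol n.+1 z) 0 0 &
      forall (n : nat) (w z : R[i]), (w^*)%R * z != 1 ->
        KL mu n w z = (1 - (w^*)%R * z)^-1 *:
          (adj (reversed (phiR mu n) w) * reversed (phiR mu n) z
           - ((w^*)%R * z) *: (adj (peval (phiL mu n) w) * peval (phiL mu n) z))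
        /\
        KR mu n w z = (1 - (w^*)%R * z)^-1 *:
          (reversed (phiL mu n) z * adj (reversed (phiL mu n) w)
           - ((w^*)%R * z) *: (peval (phiR mu n) z * adj (peval (phiR mu n) w)))].
Proof.
split=> [n w z|n w z|n w z wz1].
- by rewrite zrow_mul_zcol KRE.
- by rewrite zrow_mul_zcol KLE.
rewrite KLE// KRE//; split.
  exact: christoffel_darboux_solve wz1 (bform_TL_reversed mu_nontrivial n z w)
    (bform_TL_powers mu_nontrivial n z w).
exact: christoffel_darboux_solve wz1 (bform_TR_reversed mu_nontrivial n z w)
  (bform_TR_powers mu_nontrivial n z w).
Qed.
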